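(* Let $H$ be an infinite dimensional real or complex Hilbert space and let $1<n\in\mathbb N$. If $\phi:P_n(H)\to P_n(H)$ is a map such that $\angle(\phi(P),\phi(Q))=\angle(P,Q)$ for all $P,Q\in P_n(H)$, then there exists a linear or conjugate-linear isometry $V$ on $H$ such that $\phi(P)=VPV^*$ for all $P\in P_n(H)$.
   Context: A projection means a self-adjoint idempotent bounded operator on $H$; $P_n(H)$ is the set of all rank-$n$ projections. For projections $P,Q,P',Q'$, ''$\angle(P,Q)=\angle(P',Q')$'' means by definition that the positive operators $QPQ$ and $Q'P'Q'$ are unitarily equivalent (orthogonally equivalent in the real case). For a conjugate-linear $V$, $V^*$ denotes the conjugate-linear operator with $\langle Vx,y\rangle=\overline{\langle x,V^*y\rangle}$; an isometry means $\|Vx\|=\|x\|$ for all $x$. *)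

(* Defs.v *)
From mathcomp Require Import all_boot all_algebra.
From mathcomp Require Import reals complex.
Set Implicit Arguments. Unset Strict Implicit. Unset Printing Implicit Defensive.
Import GRing.Theory Num.Theory.
Local Open Scope ring_scope.

(* Scalars: K is either the reals R or the complex numbers R[i];
   cj is the conjugation of K (identity on R, complex conjugation on R[i]). *)

Section HilbertDefs.
Variables (K : numFieldType) (cj : K -> K) (H : lmodType K) (ip : H -> H -> K).

Definition nsq (x : H) : K := ip x x.

Definition is_inner_product : Prop :=
  (forall (a : K) (x y z : H), ip (a *: x + y) z = a * ip x z + ip y z) /\
  (forall x y : H, ip y x = cj (ip x y)) /\
  (forall x : H, 0 <= ip x x) /\
  (forall x : H, ip x x = 0 -> x = 0).

Definition ip_complete : Prop :=
  forall u : nat -> H,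
    (forall e : K, 0 < e -> exists N : nat, forall m k : nat,
        (N <= m)%N -> (N <= k)%N -> nsq (u m - u k) < e) ->
    exists l : H, forall e : K, 0 < e -> exists N : nat, forall m : nat,
        (N <= m)%N -> nsq (u m - l) < e.

Definition lin_indep (n : nat) (e : 'I_n -> H) : Prop :=
  forall c : 'I_n -> K, \sum_(i < n) c i *: e i = 0 -> forall i, c i = 0.

Definition infinite_dim : Prop :=
  forall n : nat, exists e : 'I_n -> H, lin_indep e.

Definition hilbert_space : Prop := is_inner_product /\ ip_complete.

Definition linear_op (T : H -> H) : Prop :=
  forall (a : K) (x y : H), T (a *: x + y) = a *: T x + T y.

Definition conj_linear_op (T : H -> H) : Prop :=
  forall (a : K) (x y : H), T (a *: x + y) = cj a *: T x + T y.

(* bounded linear operator: ||T x|| <= c ||x||, written with squared norms (C = c^2) *)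
Definition bounded_op (T : H -> H) : Prop :=
  linear_op T /\ exists C : K, 0 <= C /\ forall x, nsq (T x) <= C * nsq x.

Definition projection (P : H -> H) : Prop :=
  bounded_op P /\ (P \o P = P) /\ (forall x y, ip (P x) y = ip x (P y)).

Definition rank_eq (n : nat) (T : H -> H) : Prop :=
  exists e : 'I_n -> H,
    lin_indep e /\ (forall i, exists y, T y = e i) /\
    (forall x, exists c : 'I_n -> K, T x = \sum_(i < n) c i *: e i).

Definition is_Pn (n : nat) (P : H -> H) : Prop := projection P /\ rank_eq n P.

Definition Pn (n : nat) := {P : H -> H | is_Pn n P}.

Definition unitary (U : H -> H) : Prop :=
  linear_op U /\ exists W : H -> H,
    (forall x y, ip (U x) y = ip x (W y)) /\ U \o W = id /\ W \o U = id.

Definition unit_equiv (A B : H -> H) : Prop :=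
  exists U W : H -> H, unitary U /\ (forall x y, ip (U x) y = ip x (W y)) /\
    B = U \o A \o W.

Definition same_angle (P Q P' Q' : H -> H) : Prop :=
  unit_equiv (Q \o P \o Q) (Q' \o P' \o Q').

Definition theorem2_for : Prop :=
  hilbert_space -> infinite_dim ->
  forall n : nat, (1 < n)%N ->
  forall phi : Pn n -> Pn n,
    (forall P Q : Pn n,
        same_angle (proj1_sig (phi P)) (proj1_sig (phi Q)) (proj1_sig P) (proj1_sig Q)) ->
    exists V Vs : H -> H,
      ((linear_op V /\ forall x y, ip (V x) y = ip x (Vs y)) \/
       (conj_linear_op V /\ forall x y, ip (V x) y = cj (ip x (Vs y)))) /\
      (forall x, nsq (V x) = nsq x) /\
      (forall P : Pn n, proj1_sig (phi P) = V \o proj1_sig P \o Vs).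

End HilbertDefs.

(* Main.v *)
(** Preservation of angles gives tr (phi P phi Q) = tr (P Q), so phi extends to
a real-linear Hilbert-Schmidt isometry of the span of the rank-n projections,
which contains e_i e_i^* for every orthonormal frame e_0, ..., e_2n.  If T_i is
the image of e_i e_i^*, the sum of the T_i over an n-set D is the projection
phi(P_D), and disjoint n-sets give orthogonal projections.  A function on more
than n indices whose sum over every n-subset vanishes is zero; applied three
times, this gives phi(P_D) T_j = 0 for j not in D, then T_k T_j = 0 for
k <> j, then T_k T_k = T_k.  Hence T_i is a projection of trace 1, i.e. a
rank-one projection, and phi induces a map of rank-one projections that
preserves transition probabilities, which Wigner's theorem (in its
non-surjective form) implements by a linear or conjugate-linear isometry V. *)

Require Import Defs.
From mathcomp Require Import all_boot all_order all_algebra.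
From mathcomp Require Import boolp reals complex ring lra.
Set Implicit Arguments. Unset Strict Implicit. Unset Printing Implicit Defensive.
Import Order.TTheory GRing.Theory Num.Theory.
Local Open Scope ring_scope.

(** * Functions on a finite set with vanishing sums over n-subsets *)

Lemma subset_of_card (T : finType) (A : {set T}) k : (k <= #|A|)%N ->
  exists2 B : {set T}, B \subset A & #|B| = k.
Proof.
move=> kA; exists [set x in take k (enum A)].
  by apply/subsetP => x; rewrite inE => /mem_take; rewrite mem_enum.
rewrite cardsE (card_uniqP (take_uniq _ (enum_uniq _))) size_takel //.
by rewrite -cardE.
Qed.

(** Exchanging an element [d] of an n-set for an outside [c] keeps the sum zero, so [g d = g c];
    hence [n] times [g c] is zero. *)
Lemma sums_eq0 (K : numFieldType) (T : finType) (S : {set T}) (V : lmodType K)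
    (g : T -> V) n : (0 < n)%N -> (n < #|S|)%N ->
  (forall C : {set T}, C \subset S -> #|C| = n -> \sum_(c in C) g c = 0) ->
  forall c, c \in S -> g c = 0.
Proof.
move=> n0 nS g0 c cS.
have [C CS Cn] : exists2 C : {set T}, C \subset S :\ c & #|C| = n.
  by apply: subset_of_card; move: nS; rewrite (cardsD1 c) cS.
have cC : c \notin C by apply/negP => /(subsetP CS); rewrite !inE eqxx.
have CS' : C \subset S by apply: subset_trans CS (subD1set _ _).
have gE d : d \in C -> g d = g c.
  move=> dC; have := g0 _ CS' Cn; rewrite (big_setD1 d dC) /= => e1.
  have cCd : c \notin C :\ d by rewrite !inE negb_and cC orbT.
  have : \sum_(k in c |: C :\ d) g k = 0.
    apply: g0.
      apply/subsetP => x; rewrite !inE => /orP[/eqP->//|/andP[_ xC]].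
      exact: (subsetP CS').
    by rewrite cardsU1 cCd -Cn (cardsD1 d C) dC.
  rewrite big_setU1 //= => e2.
  by apply: (@addIr _ (\sum_(k in C :\ d) g k)); rewrite e1 e2.
have := g0 _ CS' Cn; rewrite (eq_bigr (fun=> g c)) // sumr_const Cn => /eqP.
by rewrite -scaler_nat scaler_eq0 pnatr_eq0 -[n == 0%N]negbK -lt0n n0 => /eqP.
Qed.

(* Common axiomatisation of the two scalar fields: K is R or R[i], with real
   part re and embedding iota of the reals. *)
Record conj_scalars (R : realType) (K : numFieldType) (cj : K -> K)
    (iota : R -> K) (re : K -> R) : Prop := ConjScalars {
  conj_scalarsK : involutive cj;
  conj_scalars_mul_ge0 : forall x, 0 <= x * cj x;
  conj_scalars_ge0_fix : forall x, 0 <= x -> cj x = x;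
  conj_scalars_iota_fix : forall r, cj (iota r) = iota r;
  conj_scalars_iota_ge0 : forall r, (0 <= iota r) = (0 <= r);
  conj_scalars_iota_re : forall x, iota (re x) = (x + cj x) / 2 }.

(** * Scalars and the inner product *)

Section Hilbert.
Variables (R : realType) (K : numFieldType) (cj : {rmorphism K -> K}).
Variables (iota : {rmorphism R -> K}) (re : K -> R).
Hypothesis scal : conj_scalars cj iota re.

Let cjK : involutive cj := conj_scalarsK scal.
Let iota_fix r : cj (iota r) = iota r := conj_scalars_iota_fix scal r.

Lemma iota_inj : injective iota. Proof. exact: fmorph_inj. Qed.

Lemma iota_le a b : (iota a <= iota b) = (a <= b).
Proof. by rewrite -subr_ge0 -rmorphB (conj_scalars_iota_ge0 scal) subr_ge0. Qed.

Lemma iota_lt a b : (iota a < iota b) = (a < b).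
Proof. by rewrite !lt_def iota_le (inj_eq iota_inj). Qed.

Lemma iota_reE x : iota (re x) = (x + cj x) / 2.
Proof. exact: (conj_scalars_iota_re scal). Qed.

Lemma iota_re_fix x : cj x = x -> iota (re x) = x.
Proof.
move=> xr; rewrite iota_reE xr -mulr2n -[x *+ 2]mulr_natr mulfK //.
by rewrite pnatr_eq0.
Qed.

Lemma re_iota r : re (iota r) = r.
Proof. by apply: iota_inj; rewrite iota_re_fix. Qed.

Lemma re_ge0 x : 0 <= x -> 0 <= re x.
Proof.
move=> x0; rewrite -(conj_scalars_iota_ge0 scal) iota_re_fix //.
exact: (conj_scalars_ge0_fix scal).
Qed.

Lemma reD x y : re (x + y) = re x + re y.
Proof. by apply: iota_inj; rewrite rmorphD !iota_reE rmorphD; ring. Qed.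

Lemma reN x : re (- x) = - re x.
Proof. by apply: iota_inj; rewrite rmorphN !iota_reE rmorphN; ring. Qed.

Lemma reZ r x : re (iota r * x) = r * re x.
Proof. by apply: iota_inj; rewrite rmorphM !iota_reE rmorphM iota_fix; ring. Qed.

Lemma re_cj x : re (cj x) = re x.
Proof. by apply: iota_inj; rewrite !iota_reE cjK addrC. Qed.

Lemma re0 : re 0 = 0. Proof. by rewrite -(rmorph0 iota) re_iota. Qed.

Lemma mul_cj_eq0 x : x * cj x = 0 -> x = 0.
Proof. by move/eqP; rewrite mulf_eq0 fmorph_eq0 orbb => /eqP. Qed.

Lemma iota_ge0P x : 0 <= x -> exists2 r, 0 <= r & x = iota r.
Proof.
move=> x0; exists (re x); first exact: re_ge0.
by rewrite iota_re_fix //; apply: (conj_scalars_ge0_fix scal).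
Qed.

Variables (H : lmodType K) (ip : H -> H -> K).
Hypothesis ip_inner : is_inner_product cj ip.

Let ipDZl a x y z : ip (a *: x + y) z = a * ip x z + ip y z := ip_inner.1 a x y z.

Lemma ipC x y : ip y x = cj (ip x y). Proof. exact: ip_inner.2.1. Qed.
Lemma ip_ge0 x : 0 <= ip x x. Proof. exact: ip_inner.2.2.1. Qed.
Lemma ip_eq0 x : ip x x = 0 -> x = 0. Proof. exact: ip_inner.2.2.2. Qed.

Lemma ipDl x y z : ip (x + y) z = ip x z + ip y z.
Proof. by have := ipDZl 1 x y z; rewrite scale1r mul1r. Qed.

Lemma ip0l x : ip 0 x = 0.
Proof. by apply: (@addIr _ (ip 0 x)); rewrite -ipDl !add0r. Qed.

Lemma ipZl a x y : ip (a *: x) y = a * ip x y.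
Proof. by have := ipDZl a x 0 y; rewrite ip0l !addr0. Qed.

Lemma ipNl x y : ip (- x) y = - ip x y.
Proof. by rewrite -scaleN1r ipZl mulN1r. Qed.

Lemma ipBl x y z : ip (x - y) z = ip x z - ip y z.
Proof. by rewrite ipDl ipNl. Qed.

Lemma ipDr x y z : ip x (y + z) = ip x y + ip x z.
Proof. by rewrite ipC ipDl rmorphD -!ipC. Qed.

Lemma ip0r x : ip x 0 = 0. Proof. by rewrite ipC ip0l rmorph0. Qed.

Lemma ipZr a x y : ip x (a *: y) = cj a * ip x y.
Proof. by rewrite ipC ipZl rmorphM -ipC. Qed.

Lemma ipNr x y : ip x (- y) = - ip x y.
Proof. by rewrite ipC ipNl rmorphN -ipC. Qed.

Lemma ipBr x y z : ip x (y - z) = ip x y - ip x z.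
Proof. by rewrite ipDr ipNr. Qed.

Lemma ip_suml I (s : seq I) (P : pred I) (F : I -> H) y :
  ip (\sum_(i <- s | P i) F i) y = \sum_(i <- s | P i) ip (F i) y.
Proof.
by apply: (big_morph (fun x => ip x y)) => [u v|]; rewrite ?ipDl ?ip0l.
Qed.

Lemma ip_sumr I (s : seq I) (P : pred I) (F : I -> H) y :
  ip y (\sum_(i <- s | P i) F i) = \sum_(i <- s | P i) ip y (F i).
Proof. by apply: (big_morph (ip y)) => [u v|]; rewrite ?ipDr ?ip0r. Qed.

Lemma ip_extl x y : (forall z, ip x z = ip y z) -> x = y.
Proof.
move=> xy; apply/eqP; rewrite -subr_eq0; apply/eqP/ip_eq0.
by rewrite ipBl xy subrr.
Qed.

(** The underlying real inner product; square roots and infima are taken in [R]. *)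
Definition rip (x y : H) : R := re (ip x y).

Lemma rip_nsq x : iota (rip x x) = ip x x.
Proof. by rewrite iota_re_fix // -ipC. Qed.

Lemma rip_ge0 x : 0 <= rip x x. Proof. exact/re_ge0/ip_ge0. Qed.

Lemma rip_eq0 x : rip x x = 0 -> x = 0.
Proof. by move=> x0; apply: ip_eq0; rewrite -rip_nsq x0 rmorph0. Qed.

Lemma ripC x y : rip x y = rip y x.
Proof. by rewrite /rip ipC re_cj. Qed.

Lemma ripDl x y z : rip (x + y) z = rip x z + rip y z.
Proof. by rewrite /rip ipDl reD. Qed.
Lemma ripNl x y : rip (- x) y = - rip x y.
Proof. by rewrite /rip ipNl reN. Qed.
Lemma ripZl r x y : rip (iota r *: x) y = r * rip x y.
Proof. by rewrite /rip ipZl reZ. Qed.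
Lemma ripDr x y z : rip x (y + z) = rip x y + rip x z.
Proof. by rewrite ripC ripDl !(ripC x). Qed.
Lemma ripNr x y : rip x (- y) = - rip x y.
Proof. by rewrite ripC ripNl ripC. Qed.
Lemma ripZr r x y : rip x (iota r *: y) = r * rip x y.
Proof. by rewrite ripC ripZl ripC. Qed.

Definition ripE := (ripDl, ripDr, ripNl, ripNr, ripZl, ripZr).
Definition ipE := (ipBl, ipBr, ipDl, ipDr, ipNl, ipNr, ipZl, ipZr).

(** The scalar is the inverse norm. It is real, so the dyad of [x] is a real multiple of that of a
    unit vector. *)
Lemma normalize x : x <> 0 ->
  exists a : K, [/\ a != 0, cj a = a & ip (a *: x) (a *: x) = 1].
Proof.
move=> x0; have rx0 : 0 < rip x x.
  by rewrite lt_def rip_ge0 andbT; apply/eqP => /rip_eq0.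
have s0 : 0 < Num.sqrt (rip x x) by rewrite sqrtr_gt0.
exists (iota (Num.sqrt (rip x x))^-1); split => //.
  by rewrite fmorph_eq0 invr_eq0 gt_eqF.
have sn0 : Num.sqrt (rip x x) != 0 by rewrite gt_eqF.
have ss : rip x x = Num.sqrt (rip x x) * Num.sqrt (rip x x).
  by rewrite -expr2 sqr_sqrtr // ltW.
rewrite !ipZl !ipZr iota_fix -rip_nsq -!rmorphM {3}ss.
by rewrite (mulrA _^-1 _ (Num.sqrt _)) mulVf // mul1r mulVf ?rmorph1.
Qed.

(** * Orthonormal families *)

(* only b 0, ..., b (m - 1) matter *)
Definition orthonormal (m : nat) (b : nat -> H) : Prop :=
  forall i j, (i < m)%N -> (j < m)%N -> ip (b i) (b j) = (i == j)%:R.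

Definition oproj m (b : nat -> H) (x : H) : H := \sum_(i < m) ip x (b i) *: b i.

Lemma oproj_linear m b : linear_op (oproj m b).
Proof.
move=> a x y; rewrite /oproj scaler_sumr -big_split; apply: eq_bigr => i _ /=.
by rewrite !ipE scalerDl scalerA.
Qed.

Lemma ip_oprojC m b x y : ip (oproj m b x) y = ip x (oproj m b y).
Proof.
rewrite ip_suml ip_sumr; apply: eq_bigr => i _.
by rewrite ipZl ipZr -ipC mulrC.
Qed.

Lemma ip_oproj_basis m b x i : orthonormal m b -> (i < m)%N ->
  ip (oproj m b x) (b i) = ip x (b i).
Proof.
move=> ob im; rewrite ip_suml (bigD1 (Ordinal im)) //= big1 => [|j ji].
  by rewrite ipZl ob // eqxx mulr1 addr0.
rewrite ipZl ob // (_ : _ == i = false) ?mulr0 //.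
by apply/negP => /eqP e; move/eqP: ji; apply; apply: val_inj.
Qed.

Lemma oproj_idem m b x : orthonormal m b -> oproj m b (oproj m b x) = oproj m b x.
Proof.
by move=> ob; rewrite {1 3}/oproj; apply: eq_bigr => i _; rewrite ip_oproj_basis.
Qed.

Lemma oproj_basis m b i : orthonormal m b -> (i < m)%N -> oproj m b (b i) = b i.
Proof.
move=> ob im; rewrite /oproj (bigD1 (Ordinal im)) //= big1 => [|j ji].
  by rewrite ob // eqxx scale1r addr0.
rewrite ob // (_ : i == _ = false) ?scale0r //.
by apply/negP => /eqP e; move/eqP: ji; apply; apply: val_inj.
Qed.

Definition snoc m (b : nat -> H) u k := if k == m then u else b k.

Lemma orthonormal_snoc m b u : orthonormal m b -> ip u u = 1 ->
  (forall i, (i < m)%N -> ip u (b i) = 0) -> orthonormal m.+1 (snoc m b u).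
Proof.
move=> ob u1 ub i j; rewrite /snoc !ltnS (leq_eqVlt i) (leq_eqVlt j).
have [->|im] := eqVneq i m; have [->|jm] := eqVneq j m => //= il jl.
- by rewrite ub // eq_sym (negPf jm).
- by rewrite ipC ub // rmorph0 (negPf im).
- exact: ob.
Qed.

Lemma oproj_snoc m b u x :
  oproj m.+1 (snoc m b u) x = oproj m b x + ip x u *: u.
Proof.
rewrite /oproj big_ord_recr /= /snoc eqxx; congr (_ + _).
by apply: eq_bigr => i _; rewrite ltn_eqF.
Qed.

(** Each vector of the list adds its normalised residue, if nonzero. [S] is a subspace to stay in:
    the range of a projection, or all of [H]. *)
Lemma gram_schmidt (S : H -> Prop) (s : seq H) :
  (forall a x y, S x -> S y -> S (a *: x + y)) -> S 0 ->
  (forall x, x \in s -> S x) ->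
  exists m b, [/\ orthonormal m b, forall i, (i < m)%N -> S (b i) &
    forall x, x \in s -> oproj m b x = x].
Proof.
move=> SD S0; elim: s => [|x s IH] Ss.
  by exists 0%N, (fun _ => 0); split.
have [y ys|m [b [ob Sb bs]]] := IH; first by apply: Ss; rewrite inE ys orbT.
have SZ a y : S y -> S (a *: y).
  by move=> Sy; rewrite -[_ *: _]addr0; apply: (SD).
have [r0|/eqP r0] := eqVneq (x - oproj m b x) 0.
  exists m, b; split => // y; rewrite inE => /orP[/eqP->|]; last exact: bs.
  by apply/esym/eqP; rewrite -subr_eq0 r0.
have [a [a0 _ a1]] := normalize r0; set u := a *: _ in a1.
have ub i : (i < m)%N -> ip u (b i) = 0.
  by move=> im; rewrite ipZl ipBl ip_oproj_basis // subrr mulr0.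
have upr y : ip u (oproj m b y) = 0.
  by rewrite ip_sumr big1 // => i _; rewrite ipZr ub ?mulr0.
have Su : S u.
  apply: (SZ); rewrite -scaleN1r addrC; apply: (SD).
    apply: (big_ind S) => // [v w Sv Sw|i _]; last by apply: (SZ); apply: (Sb).
    by rewrite -[v]scale1r; apply: (SD).
  by apply: Ss; rewrite mem_head.
exists m.+1, (snoc m b u); split.
- exact: orthonormal_snoc.
- move=> i; rewrite ltnS leq_eqVlt /snoc; case: eqVneq => //= _; exact: Sb.
move=> y; rewrite inE oproj_snoc => /orP[/eqP->|ys]; last first.
  by rewrite bs // -(bs _ ys) ipC upr rmorph0 scale0r addr0.
have xE : x = a^-1 *: u + oproj m b x by rewrite scalerA mulVf // scale1r subrK.
rewrite {2}xE ipDl ipZl a1 (ipC u) upr rmorph0 addr0 mulr1 addrC.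
by rewrite -xE.
Qed.

Hypothesis inf_dim : infinite_dim H.

(* m + 1 vectors in the span of b would be linearly dependent *)
Lemma orthonormal_extend1 m b : orthonormal m b ->
  exists u, ip u u = 1 /\ forall i, (i < m)%N -> ip u (b i) = 0.
Proof.
move=> ob; have [e le] := inf_dim m.+1.
have [[i r0]|/forallNP r0] := pselect (exists i, e i - oproj m b (e i) <> 0).
  have [a [_ _ a1]] := normalize r0; exists (a *: (e i - oproj m b (e i))).
  by split=> // j jm; rewrite ipZl ipBl ip_oproj_basis // subrr mulr0.
pose M := \matrix_(i < m.+1, j < m) ip (e i) (b j).
have : kermx M != 0.
  by rewrite kermx_eq0 -row_leq_rank -ltnNge ltnS rank_leq_col.
case/rowV0Pn => c /sub_kermxP cM; case/eqP; apply/rowP => i; rewrite mxE.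
apply: (le (fun i => c 0 i)); rewrite (eq_bigr (fun i =>
    \sum_(j < m) (c 0 i * ip (e i) (b j)) *: b j)) => [|k _].
  rewrite exchange_big big1 //= => j _; rewrite -scaler_suml.
  suff -> : \sum_(k < m.+1) c 0 k * ip (e k) (b j) = 0 by rewrite scale0r.
  move/rowP/(_ j): cM; rewrite !mxE; apply: etrans.
  by apply: eq_bigr => k _; rewrite mxE.
have /contrapT/eqP := r0 k; rewrite subr_eq0 => /eqP {1}->.
by rewrite scaler_sumr; apply: eq_bigr => j _; rewrite scalerA.
Qed.

Lemma orthonormal_extend e N : ip e e = 1 ->
  exists b, orthonormal N.+1 b /\ b 0%N = e.
Proof.
move=> e1; elim: N => [|N [b [ob be]]].
  exists (fun=> e); split=> // i j; rewrite !ltnS !leqn0 => /eqP-> /eqP->.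
  by rewrite e1.
have [u [u1 ub]] := orthonormal_extend1 ob.
exists (snoc N.+1 b u); split; [exact: orthonormal_snoc|exact: be].
Qed.

Lemma unit_vector_exists : exists e : H, ip e e = 1.
Proof.
have /orthonormal_extend1[e [e1 _]] : orthonormal 0 (fun=> 0) by [].
by exists e.
Qed.

(** * Finite rank operators and their trace *)

Lemma linear_op_sum (A : H -> H) : linear_op A ->
  forall I (s : seq I) (P : pred I) (F : I -> H),
  A (\sum_(i <- s | P i) F i) = \sum_(i <- s | P i) A (F i).
Proof.
move=> lA I s P F; have A0 : A 0 = 0.
  by apply: (@addIr _ (A 0)); have := lA 1 0 0; rewrite !scale1r !add0r.
by apply: (big_morph A) => // x y; have := lA 1 x y; rewrite !scale1r.
Qed.

Lemma linear_op0 (A : H -> H) : linear_op A -> A 0 = 0.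
Proof. by move=> lA; have := linear_op_sum lA [::] xpredT id; rewrite !big_nil. Qed.

Lemma linear_opD (A : H -> H) x y : linear_op A -> A (x + y) = A x + A y.
Proof. by move=> lA; have := lA 1 x y; rewrite !scale1r. Qed.

Lemma linear_opZ (A : H -> H) a x : linear_op A -> A (a *: x) = a *: A x.
Proof. by move=> lA; have := lA a x 0; rewrite (linear_op0 lA) !addr0. Qed.

Lemma linear_opB (A : H -> H) x y : linear_op A -> A (x - y) = A x - A y.
Proof. by move=> lA; rewrite -scaleN1r linear_opD // linear_opZ // scaleN1r. Qed.

Definition selfadj (A : H -> H) : Prop := forall x y, ip (A x) y = ip x (A y).

(* a pair (u, v) stands for the rank-one operator u v^* *)
Definition fr (s : seq (H * H)) (x : H) : H := \sum_(p <- s) ip x p.2 *: p.1.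

(** The trace as a relation, read off any decomposition of [A] into rank-one operators; it entails
    finite rank. *)
Definition is_tr (A : H -> H) (t : K) : Prop :=
  exists2 s, A =1 fr s & t = \sum_(p <- s) ip p.1 p.2.

Definition fin_rank (A : H -> H) : Prop := exists s, A =1 fr s.

(** Expanding each [p.2] in [b] makes the sum depend on the operator [fr s] alone. *)
Lemma tr_orthonormal s m b : orthonormal m b ->
  (forall p, p \in s -> oproj m b p.2 = p.2) ->
  \sum_(p <- s) ip p.1 p.2 = \sum_(i < m) ip (fr s (b i)) (b i).
Proof.
move=> ob bs; under [RHS]eq_bigr => i _ do rewrite ip_suml.
rewrite exchange_big; apply: eq_big_seq => p /bs {1}<-.
rewrite ip_sumr; apply: eq_bigr => i _.
by rewrite ipZl ipZr -ipC.
Qed.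

Lemma spanning_orthonormal (s : seq H) :
  exists m b, orthonormal m b /\ forall x, x \in s -> oproj m b x = x.
Proof.
have [//|//|//|m [b [ob _ bs]]] := @gram_schmidt (fun=> True) s.
by exists m, b.
Qed.

(** One orthonormal family serving both decompositions turns both sums into the same diagonal
    sum. *)
Lemma is_tr_uniq A t u : is_tr A t -> is_tr A u -> t = u.
Proof.
move=> [s As ->] [r Ar ->].
have [m [b [ob bsr]]] := spanning_orthonormal (map snd (s ++ r)).
rewrite !(tr_orthonormal ob).
- by apply: eq_bigr => i _; rewrite -As -Ar.
- by move=> p pr; apply/bsr/map_f; rewrite mem_cat pr orbT.
- by move=> p ps; apply/bsr/map_f; rewrite mem_cat ps.
Qed.

Lemma is_tr_ext A B t : A =1 B -> is_tr A t -> is_tr B t.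
Proof. by move=> AB [s As ->]; exists s => // x; rewrite -AB. Qed.

Lemma is_tr0 : is_tr (fun=> 0) 0.
Proof. by exists [::] => [x|]; rewrite /fr big_nil. Qed.

Lemma is_trD A B t u : is_tr A t -> is_tr B u -> is_tr (fun x => A x + B x) (t + u).
Proof.
move=> [s As ->] [r Br ->]; exists (s ++ r); last by rewrite big_cat.
by move=> x; rewrite /fr big_cat As Br.
Qed.

Lemma is_trZ A t a : is_tr A t -> is_tr (fun x => a *: A x) (a * t).
Proof.
move=> [s As ->]; exists [seq (a *: p.1, p.2) | p <- s].
  move=> x; rewrite /fr big_map As scaler_sumr; apply: eq_bigr => p _ /=.
  by rewrite !scalerA mulrC.
by rewrite big_map mulr_sumr; apply: eq_bigr => p _; rewrite ipZl.
Qed.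

(** Cyclicity of the trace: u v^* B = u (B v)^* and B u v^* = (B u) v^* both have trace <B u, v>. *)
Lemma is_tr_comp A B : fin_rank A -> linear_op B -> selfadj B ->
  exists t, is_tr (A \o B) t /\ is_tr (B \o A) t.
Proof.
move=> [s As] lB sB; exists (\sum_(p <- s) ip (B p.1) p.2); split.
  exists [seq (p.1, B p.2) | p <- s].
    by move=> x /=; rewrite As /fr big_map; apply: eq_bigr => p _; rewrite sB.
  by rewrite big_map; apply: eq_bigr => p _; rewrite sB.
exists [seq (B p.1, p.2) | p <- s]; last by rewrite big_map.
move=> x /=; rewrite As /fr big_map linear_op_sum //.
by apply: eq_bigr => p _; rewrite linear_opZ.
Qed.

Lemma unitary_adjoint U W : unitary ip U -> (forall x y, ip (U x) y = ip x (W y)) ->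
  (forall x, W (U x) = x) /\ forall x y, ip (U x) (U y) = ip x y.
Proof.
move=> [lU [W' [UW' [UW1 WU1]]]] UW.
have WU x : W (U x) = x.
  apply: ip_extl => y; rewrite ipC -UW UW' -ipC.
  by rewrite -[W' (U x)]/((W' \o U) x) WU1.
by split=> // x y; rewrite UW WU.
Qed.

Lemma is_tr_unitary A U W t : unitary ip U ->
  (forall x y, ip (U x) y = ip x (W y)) -> is_tr A t -> is_tr (U \o A \o W) t.
Proof.
move=> uU UW [s As ->]; have [_ Uip] := unitary_adjoint uU UW.
have [lU _] := uU; exists [seq (U p.1, U p.2) | p <- s].
  move=> x /=; rewrite As /fr big_map linear_op_sum //; apply: eq_bigr => p _.
  by rewrite linear_opZ // [in LHS]ipC -UW -ipC.
by rewrite big_map; apply: eq_bigr => p _; rewrite Uip.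
Qed.

Lemma fin_rank_comp A B : fin_rank A -> linear_op B -> fin_rank (B \o A).
Proof.
move=> [s As] lB; exists [seq (B p.1, p.2) | p <- s] => x /=.
rewrite As /fr big_map linear_op_sum //.
by apply: eq_bigr => p _; rewrite linear_opZ.
Qed.

(** These operators form a real vector space, on which tr (A B) is an inner product. *)
Definition fsa (A : H -> H) : Prop := [/\ linear_op A, selfadj A & fin_rank A].

(** tr (A A) is the sum of the |A b_i|^2 over an orthonormal family [b] such that [A] vanishes on
    the complement of its span. *)
Lemma hs_eq0 A : fsa A -> is_tr (A \o A) 0 -> A =1 fun=> 0.
Proof.
move=> [lA sA [s As]] trAA.
have [m [b [ob bs]]] := spanning_orthonormal (map snd s).
pose s' := [seq (A p.1, p.2) | p <- s].
have AAs : A \o A =1 fr s'.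
  move=> x /=; rewrite (As x) /fr big_map linear_op_sum //.
  by apply: eq_bigr => p _; rewrite linear_opZ.
have trs : is_tr (A \o A) (\sum_(p <- s') ip p.1 p.2) by exists s'.
have trE : \sum_(i < m) rip (A (b i)) (A (b i)) = 0.
  apply: (@iota_inj); rewrite rmorph0 (is_tr_uniq trAA trs) rmorph_sum.
  rewrite (tr_orthonormal ob).
    by apply: eq_bigr => i _; rewrite rip_nsq -AAs /= -sA.
  by move=> _ /mapP[p ps ->] /=; apply: (bs); apply: map_f.
have Ab i : (i < m)%N -> A (b i) = 0.
  move=> im; apply: rip_eq0.
  have /psumr_eq0P := trE.
  by move=> /(_ (fun i _ => rip_ge0 _)) /(_ (Ordinal im)); apply.
move=> x; suff -> : A x = A (oproj m b x).
  by rewrite /oproj linear_op_sum // big1 // => i _; rewrite linear_opZ // Ab ?scaler0.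
rewrite !As; apply: eq_big_seq => p ps.
by rewrite ip_oprojC bs // map_f.
Qed.

Definition dyad (u x : H) : H := ip x u *: u.

Lemma dyad_fsa u : fsa (dyad u).
Proof.
split.
- by move=> a x y; rewrite /dyad !ipE scalerDl scalerA.
- by move=> x y; rewrite /dyad ipZl ipZr -ipC mulrC.
- by exists [:: (u, u)] => x; rewrite /fr big_seq1.
Qed.

Lemma is_tr_dyad u : is_tr (dyad u) (ip u u).
Proof. by exists [:: (u, u)] => [x|]; rewrite /fr ?big_seq1. Qed.

Lemma is_tr_dyad2 u v : is_tr (dyad u \o dyad v) (ip u v * ip v u).
Proof.
exists [:: (ip v u *: u, v)] => [x|]; rewrite /fr ?big_seq1 /=.
  by rewrite /dyad ipZl scalerA.
by rewrite ipZl mulrC.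
Qed.

Lemma fsaD A B : fsa A -> fsa B -> fsa (fun x => A x + B x).
Proof.
move=> [lA sA [s As]] [lB sB [r Br]]; split.
- by move=> a x y; rewrite lA lB scalerDr addrACA.
- by move=> x y; rewrite !ipE sA sB.
- by exists (s ++ r) => x; rewrite /fr big_cat As Br.
Qed.

Lemma fsaZ r A : fsa A -> fsa (fun x => iota r *: A x).
Proof.
move=> [lA sA [s As]]; split.
- by move=> a x y; rewrite lA scalerDr !scalerA mulrC.
- by move=> x y; rewrite !ipE sA iota_fix.
have [t At _] : is_tr (fun x => iota r *: A x) (iota r * \sum_(p <- s) ip p.1 p.2).
  by apply: is_trZ; exists s.
by exists t.
Qed.

Lemma fsa_ext A B : A =1 B -> fsa A -> fsa B.
Proof. by move=> /funext ->. Qed.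

(* A projection of trace 1 minus uu^*, u a unit vector of its range, is a
   projection of trace 0. *)
Lemma trace1_projection T : fsa T -> (forall x, T (T x) = T x) -> is_tr T 1 ->
  exists u, ip u u = 1 /\ T =1 dyad u.
Proof.
move=> fT TT tr1; have [lT sT _] := fT.
have [x Tx0] : exists x, T x <> 0.
  apply: contrapT => /forallNP T0; have T00 : T =1 fun=> 0.
    by move=> x; apply: contrapT; apply: T0.
  have /eqP := is_tr_uniq (is_tr_ext T00 tr1) is_tr0.
  by rewrite oner_eq0.
have [a [_ _ u1]] := normalize Tx0; set u := a *: T x in u1.
have Tu : T u = u by rewrite linear_opZ // TT.
exists u; split => // y; apply/eqP; rewrite -subr_eq0; apply/eqP; move: y.
pose C y := T y + iota (-1) *: dyad u y.
have CE y : C y = T y - dyad u y by rewrite /C rmorphN1 scaleN1r.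
suff C0 : C =1 fun=> 0 by move=> y; rewrite -CE C0.
have [ld sd _] := dyad_fsa u.
apply: hs_eq0; first by apply: fsaD => //; apply: fsaZ; apply: dyad_fsa.
have CC : C =1 C \o C.
  move=> y /=; have Td : T (dyad u y) = dyad u y by rewrite [LHS]linear_opZ // Tu.
  have dT : dyad u (T y) = dyad u y by rewrite /dyad sT Tu.
  have dd : dyad u (dyad u y) = dyad u y by rewrite /dyad ipZl u1 mulr1.
  by rewrite !CE (linear_opB _ _ lT) (linear_opB _ _ ld) TT Td dT dd subrr subr0.
apply: is_tr_ext CC _.
have := is_trD tr1 (is_trZ (iota (-1)) (is_tr_dyad u)).
by rewrite u1 mulr1 [X in is_tr _ (1 + X)]rmorphN1 subrr.
Qed.

(** * The linear extension of an angle-preserving map *)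

Section Angle.
Variable n : nat.

(** Gram-Schmidt within the range: the family spans all [e i], so [oproj m b] fixes the range of
    [P], while [P] fixes each [b i]. *)
Lemma Pn_orthonormal (P : Pn ip n) :
  exists m b, orthonormal m b /\ sval P =1 oproj m b.
Proof.
case: P => P [[[lP _] [PP sP]] [e [_ [eP Pe]]]] /=.
pose ran x := P x = x.
have PPx x : P (P x) = P x by rewrite -[P (P x)]/((P \o P) x) PP.
have [a x y|||m [b [ob Pb be]]] :=
    @gram_schmidt ran [seq e i | i <- enum 'I_n].
- by rewrite /ran lP => -> ->.
- exact: linear_op0.
- by move=> x /mapP[i _ ->]; have [y <-] := eP i; apply: PPx.
exists m, b; split=> // x; have bP : oproj m b (P x) = P x.
  have [c ->] := Pe x; have lb := oproj_linear m b.
  rewrite linear_op_sum //; apply: eq_bigr => i _.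
  by rewrite linear_opZ // be // map_f // mem_enum.
rewrite -bP; apply: eq_bigr => i _; congr (_ *: _).
by rewrite sP Pb.
Qed.

Lemma oproj_fsa m b : fsa (oproj m b).
Proof.
split; [exact: oproj_linear | exact: ip_oprojC |].
exists [seq (b i, b i) | i : 'I_m <- index_enum 'I_m] => x.
by rewrite /fr big_map.
Qed.

Lemma Pn_fsa (P : Pn ip n) : fsa (sval P).
Proof.
have [m [b [_ /fsym Pb]]] := Pn_orthonormal P.
exact: fsa_ext Pb (oproj_fsa m b).
Qed.

Lemma Pn_idem (P : Pn ip n) x : sval P (sval P x) = sval P x.
Proof. by case: P => P [[_ [PP _]] _] /=; rewrite -[P (P x)]/((P \o P) x) PP. Qed.

Lemma oproj_is_Pn b : orthonormal n b -> is_Pn ip n (oproj n b).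
Proof.
move=> ob; split; last first.
  exists (fun i => b i); split; last split.
  - move=> c c0 i; have : ip (\sum_(i < n) c i *: b i) (b i) = 0.
      by rewrite c0 ip0l.
    rewrite ip_suml (bigD1 i) //= big1 => [|j ji].
      by rewrite ipZl ob // eqxx mulr1 addr0.
    by rewrite ipZl ob // (inj_eq val_inj) (negPf ji) mulr0.
  - by move=> i; exists (b i); rewrite oproj_basis.
  - by move=> x; exists (fun i => ip x (b i)).
have sb := @ip_oprojC n b; have lb := oproj_linear n b.
split; last by split=> //; apply/funext => x /=; rewrite oproj_idem.
split=> //; exists 1; split=> // x; rewrite mul1r /nsq -subr_ge0.
have <- : ip (x - oproj n b x) (x - oproj n b x) = ip x x - ip (oproj n b x) (oproj n b x).
  have q : ip (oproj n b x) (oproj n b x) = ip x (oproj n b x).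
    by rewrite sb oproj_idem.
  by rewrite !ipE q (sb x x); ring.
exact: ip_ge0.
Qed.

Variable phi : Pn ip n -> Pn ip n.
Hypothesis phi_angle : forall P Q : Pn ip n,
  same_angle ip (sval (phi P)) (sval (phi Q)) (sval P) (sval Q).

(** By cyclicity tr (Q P Q) = tr (P Q), and unitary equivalence preserves the trace. *)
Lemma phi_tr P Q : exists t, is_tr (sval P \o sval Q) t /\
  is_tr (sval (phi P) \o sval (phi Q)) t.
Proof.
have tr3 (P1 Q1 : Pn ip n) : exists t, is_tr (sval P1 \o sval Q1) t /\
    is_tr (sval Q1 \o sval P1 \o sval Q1) t.
  have [lP sP fP] := Pn_fsa P1; have [lQ sQ fQ] := Pn_fsa Q1.
  have [t [t1 t2]] := is_tr_comp (fin_rank_comp fQ lP) lQ sQ.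
  exists t; split; last by apply: is_tr_ext t2.
  by apply: is_tr_ext t1 => x /=; rewrite Pn_idem.
have [t [t1 t2]] := tr3 P Q; have [u [u1 u2]] := tr3 (phi P) (phi Q).
exists t; split=> //; have [U [W [uU [UW E]]]] := phi_angle P Q.
have := is_tr_unitary uU UW u2; rewrite -E => u3.
by rewrite (is_tr_uniq t2 u3).
Qed.

(* the graph of the real-linear extension of phi *)
Inductive span_rel : (H -> H) -> (H -> H) -> Prop :=
| rel_Pn P : span_rel (sval P) (sval (phi P))
| relD A A' B B' : span_rel A A' -> span_rel B B' ->
    span_rel (fun x => A x + B x) (fun x => A' x + B' x)
| relZ r A A' : span_rel A A' ->
    span_rel (fun x => iota r *: A x) (fun x => iota r *: A' x).

Lemma rel_ext A A' B B' : A =1 B -> A' =1 B' -> span_rel A A' -> span_rel B B'.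
Proof. by move=> /funext -> /funext ->. Qed.

Lemma rel_fsa A A' : span_rel A A' -> fsa A /\ fsa A'.
Proof.
elim=> {A A'} [P|A A' B B' _ [fA fA'] _ [fB fB']|r A A' _ [fA fA']].
- by split; apply: Pn_fsa.
- by split; apply: fsaD.
- by split; apply: fsaZ.
Qed.

(** Bilinearity carries [phi_tr] to the span: induction on the first pair and, when that is a
    projection with its image, on the second. *)
Lemma rel_tr A A' B B' : span_rel A A' -> span_rel B B' ->
  exists t, is_tr (A \o B) t /\ is_tr (A' \o B') t.
Proof.
move=> rA rB; elim: rA => {A A'}
    [P|A A' C C' _ [t [t1 t2]] _ [u [u1 u2]]|r A A' _ [t [t1 t2]]].
- elim: rB => {B B'} [Q|B B' C C' _ [t [t1 t2]] _ [u [u1 u2]]|r B B' _ [t [t1 t2]]].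
  + exact: phi_tr.
  + exists (t + u); split.
      apply: is_tr_ext (is_trD t1 u1) => x /=.
      by rewrite linear_opD //; case: (Pn_fsa P).
    apply: is_tr_ext (is_trD t2 u2) => x /=.
    by rewrite linear_opD //; case: (Pn_fsa (phi P)).
  + exists (iota r * t); split.
      apply: is_tr_ext (is_trZ _ t1) => x /=.
      by rewrite linear_opZ //; case: (Pn_fsa P).
    apply: is_tr_ext (is_trZ _ t2) => x /=.
    by rewrite linear_opZ //; case: (Pn_fsa (phi P)).
- by exists (t + u); split; [exact: is_trD t1 u1|exact: is_trD t2 u2].
- by exists (iota r * t); split; [exact: is_trZ t1|exact: is_trZ t2].
Qed.

Lemma rel_is_tr A A' B B' t : span_rel A A' -> span_rel B B' ->
  is_tr (A \o B) t -> is_tr (A' \o B') t.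
Proof.
move=> rA rB tAB; have [u [u1 u2]] := rel_tr rA rB.
by rewrite (is_tr_uniq tAB u1).
Qed.

(** The relation preserves tr (A A), whose vanishing forces the operator to vanish. By linearity the
    extension is then well defined. *)
Lemma rel0 A A' : span_rel A A' -> A =1 (fun=> 0) -> A' =1 fun=> 0.
Proof.
move=> rA A0; apply: hs_eq0; first by case: (rel_fsa rA).
apply: (rel_is_tr rA rA); apply: is_tr_ext is_tr0 => x /=.
by rewrite A0.
Qed.

Lemma relB A A' B B' : span_rel A A' -> span_rel B B' ->
  span_rel (fun x => A x - B x) (fun x => A' x - B' x).
Proof.
move=> rA /(relZ (-1)) rB; apply: rel_ext (relD rA rB) => x /=;
  by rewrite rmorphN1 scaleN1r.
Qed.

Lemma rel_fun A A' B B' : span_rel A A' -> span_rel B B' -> A =1 B -> A' =1 B'.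
Proof.
move=> rA rB AB x; apply/eqP; rewrite -subr_eq0; apply/eqP; move: x.
by apply: rel0 (relB rA rB) _ => x; rewrite AB subrr.
Qed.

(** If P Q = 0 then Q P Q = 0, so its unitary copy B = phi(Q) phi(P) phi(Q) is 0, and |phi(P) phi(Q)
    x|^2 = <x, B x>. *)
Lemma phi_orth P Q : (forall x, sval P (sval Q x) = 0) ->
  forall x, sval (phi P) (sval (phi Q) x) = 0.
Proof.
move=> PQ0 x; have [U [W [uU [UW E]]]] := phi_angle P Q.
have [WU Uip] := unitary_adjoint uU UW.
have [lQ sQ _] := Pn_fsa (phi Q); have [lP sP _] := Pn_fsa (phi P).
set B := sval (phi Q) \o sval (phi P) \o sval (phi Q) in E.
have UB : U (B x) = 0.
  rewrite -[x]WU -[U (B _)]/((U \o B \o W) (U x)) -E /= PQ0.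
  by apply: linear_op0; case: (Pn_fsa Q).
have Bx : B x = 0 by apply: ip_eq0; rewrite -Uip UB ip0l.
by apply: ip_eq0; rewrite sP Pn_idem sQ -[ip _ _]/(ip x (B x)) Bx ip0r.
Qed.

Hypothesis n_gt0 : (0 < n)%N.

(** The empty sum requires the zero pair, which the relation contains only once some rank-n
    projection is at hand. *)
Lemma rel_sum I (s : seq I) (P : pred I) (F G : I -> H -> H) :
  span_rel (fun=> 0) (fun=> 0) -> (forall i, P i -> span_rel (F i) (G i)) ->
  span_rel (fun x => \sum_(i <- s | P i) F i x) (fun x => \sum_(i <- s | P i) G i x).
Proof.
move=> r0 rFG; elim: s => [|i s IH].
  by apply: rel_ext r0 => x; rewrite big_nil.
have [Pi|nPi] := boolP (P i); last first.
  by apply: rel_ext IH => x; rewrite big_cons (negPf nPi).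
by apply: rel_ext (relD (rFG _ Pi) IH) => x; rewrite big_cons Pi.
Qed.

(** * Images of the dyads of an orthonormal frame *)

Section Frame.
Variable b : nat -> H.
(** With 2n + 1 indices, the complement of an n-set has n + 1 elements, enough for [sums_eq0]. *)
Let N := (n + n).+1.
Hypothesis ob : orthonormal N b.

Lemma Pn_of_set (A : {set 'I_N}) : #|A| = n ->
  exists P : Pn ip n, sval P =1 fun x => \sum_(i in A) dyad (b i) x.
Proof.
move=> An; pose b' k := b (nth ord0 (enum A) k).
have sA : size (enum A) = n by rewrite -cardE.
have ob' : orthonormal n b'.
  move=> i j ilt jlt; rewrite ob ?ltn_ord // (inj_eq val_inj).
  by rewrite nth_uniq ?sA ?enum_uniq.
exists (exist _ _ (oproj_is_Pn ob')) => x /=.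
rewrite -big_enum (big_nth ord0) sA big_mkord.
by apply: eq_bigr.
Qed.

Lemma rel_frame0 : span_rel (fun=> 0) (fun=> 0).
Proof.
have [D _ Dn] : exists2 D : {set 'I_N}, D \subset [set: 'I_N] & #|D| = n.
  by apply: subset_of_card; rewrite cardsT card_ord /N ltnW // ltnS leq_addr.
have [P _] := Pn_of_set Dn.
by apply: rel_ext (relZ 0 (rel_Pn P)) => x; rewrite rmorph0 scale0r.
Qed.

(** Write E_j for the dyad of [b j] and P_D for the sum of E_j over D. For i outside D, exchanging j
    in D for i changes P_D by E_i - E_j; P_D plus all these differences is n E_i. *)
Lemma rel_frame : exists T : 'I_N -> H -> H,
  forall i : 'I_N, span_rel (dyad (b i)) (T i).
Proof.
suff ex (i : 'I_N) : exists T, span_rel (dyad (b i)) T.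
  by have [T] := fin_all_exists ex; exists T.
have [D Di Dn] : exists2 D : {set 'I_N}, D \subset ~: [set i] & #|D| = n.
  by apply: subset_of_card; rewrite cardsC1 card_ord leq_addr.
have iD : i \notin D by apply/negP => /(subsetP Di); rewrite !inE eqxx.
have [P PD] := Pn_of_set Dn.
have ex (j : 'I_N) : exists G, j \in D ->
    span_rel (fun x => dyad (b i) x - dyad (b j) x) G.
  (* The zero map is a filler off [D], since [fin_all_exists] chooses for every [j]. *)
  have [jD|] := boolP (j \in D); last by exists (fun=> 0).
  have Dn' : #|i |: D :\ j| = n.
    rewrite cardsU1 !inE negb_and iD orbT add1n.
    by have := cardsD1 j D; rewrite jD add1n Dn => ->.
  have [Q QD] := Pn_of_set Dn'.
  exists (fun x => sval (phi Q) x - sval (phi P) x) => _.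
  apply: rel_ext (relB (rel_Pn Q) (rel_Pn P)) => // x.
  rewrite QD PD (big_setD1 j jD) big_setU1 /=; last by rewrite !inE negb_and iD orbT.
  by rewrite opprD addrACA subrr addr0.
have [G rG] := fin_all_exists ex.
have := relZ n%:R^-1 (relD (rel_Pn P) (rel_sum (index_enum _) rel_frame0 rG)).
set T := (X in span_rel _ X) => rT; exists T; apply: rel_ext rT => // x.
rewrite PD -big_split /= (eq_bigr (fun=> dyad (b i) x)) => [|j _]; last first.
  by rewrite addrC subrK.
rewrite sumr_const Dn -scaler_nat scalerA fmorphV rmorph_nat mulVf ?scale1r //.
by rewrite pnatr_eq0 -lt0n.
Qed.

Lemma frame_dyad i : (i < N)%N -> exists u, span_rel (dyad (b i)) (dyad u).
Proof.
have [T rT] := rel_frame; move=> iN.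
have lT k : linear_op (T k) by have [_ []] := rel_fsa (rT k).
have pE (A : {set 'I_N}) : #|A| = n -> exists P : Pn ip n,
    (sval P =1 fun x => \sum_(i in A) dyad (b i) x) /\
    (sval (phi P) =1 fun x => \sum_(i in A) T i x).
  move=> An; have [P PA] := Pn_of_set An; exists P; split=> //.
  apply: (rel_fun (rel_Pn P) _ PA).
  by apply: rel_sum => //; apply: rel_frame0.
have orth (A C : {set 'I_N}) : #|A| = n -> #|C| = n -> [disjoint A & C] ->
    forall x, \sum_(k in A) T k (\sum_(j in C) T j x) = 0.
  move=> /pE[P [P1 P2]] /pE[Q [Q1 Q2]] AC x.
  rewrite -P2 -Q2; apply: phi_orth => {}x; rewrite P1 Q1 big1 // => k kA.
  rewrite /dyad ip_suml big1 ?scale0r // => j jC.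
  rewrite ipZl ob // (inj_eq val_inj) (_ : _ == _ = false) ?mulr0 //.
  by apply/negP => /eqP jk; have /negP := disjointFr AC kA; rewrite -jk.
(* Here [j] varies over the n + 1 indices outside [D]; [orth] annihilates the sum over each
   n-subset. *)
have pT (D : {set 'I_N}) j x : #|D| = n -> j \notin D ->
    \sum_(k in D) T k (T j x) = 0.
  move=> Dn jD; apply: (@sums_eq0 _ _ (~: D) _ (fun j => \sum_(k in D) T k (T j x)) n).
  - exact: n_gt0.
  - by rewrite -(ltn_add2l #|D|) cardsC card_ord Dn.
  - move=> C CD Cn; rewrite exchange_big -[RHS](orth D C _ _ _ x) //=.
      by apply: eq_bigr => k _; rewrite linear_op_sum.
    by rewrite disjoint_sym disjoints_subset.
  - by rewrite inE.
(* Here [k] varies over the 2n indices other than [j], and [pT] annihilates the sums. *)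
have TT k j x : k != j -> T k (T j x) = 0.
  move=> kj; apply: (@sums_eq0 _ _ (~: [set j]) _ (fun k => T k (T j x)) n).
  - exact: n_gt0.
  - by rewrite cardsC1 card_ord -addn1 leq_add2l.
  - move=> C Cj Cn; apply: pT => //.
    by apply/negP => /(subsetP Cj); rewrite !inE eqxx.
  - by rewrite !inE.
(* Here [k] varies over all indices: phi(P_C) is idempotent and its cross terms vanish by [TT]. *)
have Tid k x : T k (T k x) = T k x.
  apply/eqP; rewrite -subr_eq0; apply/eqP.
  apply: (@sums_eq0 _ _ [set: 'I_N] _ (fun k => T k (T k x) - T k x) n).
  - exact: n_gt0.
  - by rewrite cardsT card_ord ltnS leq_addr.
  - move=> C _ Cn; rewrite sumrB; have [P [_ PT]] := pE _ Cn.
    rewrite -PT -Pn_idem !PT; apply/eqP; rewrite subr_eq0; apply/eqP.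
    apply: eq_bigr => j jC; rewrite linear_op_sum // (bigD1 j) //= big1 ?addr0 //.
    by move=> l /andP[_ lj]; apply: TT; rewrite eq_sym.
  - by rewrite inE.
pose i' := Ordinal iN; have b1 : ip (b i) (b i) = 1 by rewrite ob // eqxx.
have [_ fT] := rel_fsa (rT i').
(* Traces of products are what the relation preserves, so tr T_i is computed as tr (T_i T_i) = tr
   (E_i E_i) = 1. *)
have tr1 : is_tr (T i') 1.
  apply: is_tr_ext (Tid i') _; apply: (rel_is_tr (rT i') (rT i')).
  by rewrite -[1]mulr1 -{1 2}b1; apply: is_tr_dyad2.
have [u [_ Tu]] := trace1_projection fT (Tid i') tr1.
by exists u; apply: rel_ext (rT i').
Qed.
End Frame.

Lemma rel_dyad_unit e : ip e e = 1 -> exists u, span_rel (dyad e) (dyad u).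
Proof.
move=> /(orthonormal_extend (n + n))[b [ob <-]].
exact: frame_dyad ob _ _.
Qed.

Lemma dyadZ a u x : dyad (a *: u) x = (cj a * a) *: dyad u x.
Proof. by rewrite /dyad ipZr !scalerA -!mulrA (mulrC _ a). Qed.

Lemma rel_dyad x : exists y, span_rel (dyad x) (dyad y).
Proof.
have [->|/eqP x0] := eqVneq x 0.
  have [e e1] := unit_vector_exists; have [u ru] := rel_dyad_unit e1.
  by exists 0; apply: rel_ext (relZ 0 ru) => y; rewrite rmorph0 scale0r /dyad scaler0.
have [a [a0 ar /rel_dyad_unit[u ru]]] := normalize x0.
exists (a^-1 *: u); have ar' : cj a^-1 = a^-1 by rewrite fmorphV ar.
have cr : iota (re (a^-1 * a^-1)) = a^-1 * a^-1.
  by rewrite iota_re_fix // rmorphM /= ar'.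
apply: rel_ext (relZ (re (a^-1 * a^-1)) ru) => y; rewrite cr !dyadZ ?ar' //.
by rewrite scalerA ar mulrACA mulVf // mulr1 scale1r.
Qed.

(** The trace of [dyad x \o dyad y] is |<x, y>|^2, and the extension preserves it. *)
Lemma dyad_map : exists f : H -> H, (forall x, span_rel (dyad x) (dyad (f x))) /\
  forall x y, ip (f x) (f y) * ip (f y) (f x) = ip x y * ip y x.
Proof.
have [f rf] := choice rel_dyad; exists f; split=> // x y.
apply: is_tr_uniq (is_tr_dyad2 _ _) _.
exact: rel_is_tr (rf x) (rf y) (is_tr_dyad2 _ _).
Qed.
End Angle.

(** * Wigner's theorem *)

(** A group is not the union of two proper subgroups: if [x] is outside [A] and [y] outside [B],
    then [x + y] lies in neither. *)
Lemma union_subgroups (V : zmodType) (D A B : V -> Prop) :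
  (forall x y, D x -> D y -> D (x + y)) ->
  (forall x y, D x -> D y -> A (x + y) -> A y -> A x) ->
  (forall x y, D x -> D y -> B (x + y) -> B x -> B y) ->
  (forall x, D x -> A x \/ B x) ->
  (forall x, D x -> A x) \/ (forall x, D x -> B x).
Proof.
move=> DD AA BB AB; apply: contrapT => /not_orP[/existsNP[x /not_implyP[Dx nAx]]].
move=> /existsNP[y /not_implyP[Dy nBy]].
have Bx : B x by case: (AB x Dx).
have Ay : A y by case: (AB y Dy).
by case: (AB _ (DD _ _ Dx Dy)) => [Axy|Bxy]; [exact/nAx/(AA x y)|exact/nBy/(BB x y)].
Qed.

(** |v|^2 times the squared distance of [u] from its projection on [v] is |u|^2 |v|^2 - |<u,
    v>|^2. *)
Lemma cauchy_schwarz_eq u v : v <> 0 -> ip u v * ip v u = ip u u * ip v v ->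
  u = (ip u v / ip v v) *: v.
Proof.
move=> v0 cs; have q0 : ip v v != 0 by apply/eqP => /ip_eq0.
apply/eqP; rewrite -subr_eq0; apply/eqP/ip_eq0.
have cq : cj (ip v v) = ip v v by rewrite -ipC.
rewrite !ipE rmorphM fmorphV cq -ipC.
apply: (@mulfI _ (ip v v)) => //; rewrite mulr0.
transitivity (ip u u * ip v v - ip u v * ip v u); last by rewrite cs subrr.
by field.
Qed.

(** Equality in Cauchy-Schwarz with equal norms leaves only a phase between [u] and [v], which dyads
    do not see. *)
Lemma dyad_eq u v : ip u u = ip v v -> ip u v * ip v u = ip u u * ip v v ->
  dyad u =1 dyad v.
Proof.
move=> uv cs x; have [v0|/eqP v0] := eqVneq v 0.
  by have -> : u = v by rewrite v0 in uv *; apply: ip_eq0; rewrite uv ip0l.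
have := cauchy_schwarz_eq v0 cs; move: (_ / _) => a ua.
have q0 : ip v v != 0 by apply/eqP => /ip_eq0.
rewrite ua dyadZ (_ : cj a * a = 1) ?scale1r //.
have vE : ip v v = a * (cj a * ip v v) by rewrite -{1}uv ua ipZl ipZr.
by apply: (mulIf q0); rewrite mul1r [RHS]vE mulrA (mulrC a).
Qed.

Lemma dyad_transition u u' v v' : dyad u =1 dyad u' -> dyad v =1 dyad v' ->
  ip u v * ip v u = ip u' v' * ip v' u'.
Proof.
move=> uu vv; apply: is_tr_uniq (is_tr_dyad2 u v) _.
by apply: is_tr_ext (is_tr_dyad2 u' v') => x /=; rewrite uu vv.
Qed.

Lemma eq_sqr_ge0 (x y : K) : 0 <= x -> 0 <= y -> x * x = y * y -> x = y.
Proof.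
move=> x0 y0 /eqP; rewrite -!expr2 eqrXn2 //; exact/eqP.
Qed.

Section Wigner.
Variable f : H -> H.
Hypothesis f_transition : forall x y,
  ip (f x) (f y) * ip (f y) (f x) = ip x y * ip y x.

Lemma wigner_norm x : ip (f x) (f x) = ip x x.
Proof. by apply: eq_sqr_ge0; rewrite ?ip_ge0 // f_transition. Qed.

Lemma wigner_scale a y : dyad (f (a *: y)) =1 dyad (a *: f y).
Proof.
apply: dyad_eq.
  by rewrite wigner_norm ipZl ipZr [RHS]ipZl ipZr wigner_norm.
rewrite wigner_norm [ip (f _) _]ipZr [ip (a *: f y) _]ipZl mulrACA f_transition.
by rewrite !ipZl !ipZr wigner_norm; ring.
Qed.

Variable e : H.
Hypothesis e1 : ip e e = 1.
Let e' := f e.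
Let e1' : ip e' e' = 1. Proof. by rewrite wigner_norm. Qed.

(* f (e + z) with the phase for which its component along f e is f e *)
Let g z := cj (ip (f (e + z)) e') *: f (e + z).
(** [S z] is the deviation of [g z] from [f e]; on the complement of [e] it will be the isometry to
    extend. *)
Let S_spec : {S : H -> H | forall z, g z = e' + S z}.
Proof. by exists (fun z => g z - e') => z; rewrite addrC subrK. Qed.
Let S := sval S_spec.
Let perp z := ip z e = 0.

Let perpZ a x : perp x -> perp (a *: x).
Proof. by rewrite /perp ipZl => ->; rewrite mulr0. Qed.

Let perpDD x y : perp x -> perp y -> perp (x + y).
Proof. by rewrite /perp !ipE => -> ->; rewrite addr0. Qed.

Let perp_sym z : perp z -> ip e z = 0.
Proof. by rewrite /perp ipC => z0; rewrite -[LHS]cjK z0 rmorph0. Qed.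

(** |<f (e + z), f e>| = |<e + z, e>| = 1. *)
Let phase z : perp z -> cj (ip (f (e + z)) e') * ip (f (e + z)) e' = 1.
Proof.
move=> z0; rewrite -ipC mulrC f_transition !ipE e1 z0 perp_sym //.
by rewrite !addr0 mulr1.
Qed.

Let g_dyad z : perp z -> dyad (g z) =1 dyad (f (e + z)).
Proof. by move=> z0 x; rewrite dyadZ cjK mulrC phase // scale1r. Qed.

Let gE z : g z = e' + S z. Proof. exact: (svalP S_spec). Qed.

Let S_perp z : perp z -> ip (S z) e' = 0.
Proof. move=> z0; apply: (@addrI _ 1); rewrite -{1}e1' -ipDl -gE ipZl phase //.
by rewrite addr0. Qed.

Let S_perp' z : perp z -> ip e' (S z) = 0.
Proof. by move=> z0; rewrite ipC S_perp ?rmorph0. Qed.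

Let S_norm z : perp z -> ip (S z) (S z) = ip z z.
Proof.
move=> z0; apply: (@addrI _ 1).
transitivity (ip (g z) (g z)).
  by rewrite gE !ipE e1' S_perp ?S_perp' // addr0 add0r.
rewrite ipZl ipZr cjK mulrA phase // mul1r wigner_norm !ipE e1 z0.
by rewrite perp_sym // addr0 add0r.
Qed.

(** Since [f z] is orthogonal to [f e], <S z, f z> = <g z, f z>, of modulus |<e + z, z>| = |z|^2:
    equality in Cauchy-Schwarz. *)
Let S_dyad z : perp z -> dyad (S z) =1 dyad (f z).
Proof.
move=> z0; apply: dyad_eq; first by rewrite S_norm // wigner_norm.
have fe : ip (f z) e' = 0.
  apply: mul_cj_eq0; rewrite -ipC f_transition z0 mul0r //.
have fe' : ip e' (f z) = 0 by rewrite ipC fe rmorph0.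
have -> : ip (S z) (f z) = ip (g z) (f z) by rewrite gE ipDl fe' add0r.
have -> : ip (f z) (S z) = ip (f z) (g z) by rewrite gE ipDr fe add0r.
rewrite (dyad_transition (g_dyad z0) (fun=> erefl)) f_transition.
by rewrite S_norm // wigner_norm !ipE z0 perp_sym // !add0r.
Qed.

Let S_transition z w : perp z -> perp w ->
  ip (S z) (S w) * ip (S w) (S z) = ip z w * ip w z.
Proof. by move=> z0 w0; rewrite (dyad_transition (S_dyad z0) (S_dyad w0)). Qed.

(** Transition probabilities of e + z and e + w give |1 + <S z, S w>| = |1 + <z, w>|; as |<S z, S
    w>| = |<z, w>|, the real parts agree. *)
Let S_re z w : perp z -> perp w ->
  ip (S z) (S w) + ip (S w) (S z) = ip z w + ip w z.
Proof.
move=> z0 w0; have st := S_transition z0 w0.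
have := dyad_transition (g_dyad z0) (g_dyad w0); rewrite f_transition.
rewrite !gE !ipE e1 e1' z0 w0 !S_perp ?S_perp' // !perp_sym // => gt.
apply: (@addrI _ 1); apply: (@addIr _ (ip (S z) (S w) * ip (S w) (S z))).
rewrite [in RHS]st; transitivity ((1 + ip (S z) (S w)) * (1 + ip (S w) (S z))).
  by ring.
transitivity ((1 + ip z w) * (1 + ip w z)); last by ring.
by move: gt; rewrite !addr0 !add0r.
Qed.

Let S_rip z w : perp z -> perp w -> rip (S z) (S w) = rip z w.
Proof.
move=> z0 w0; apply: iota_inj; rewrite !iota_reE -!ipC S_re //.
Qed.

(** |S (z + w) - S z - S w|^2 expands into real inner products, all preserved by [S]. *)
Let S_add z w : perp z -> perp w -> S (z + w) = S z + S w.
Proof.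
move=> z0 w0; have zw0 := perpDD z0 w0.
apply/eqP; rewrite -subr_eq0; apply/eqP/rip_eq0.
by rewrite !ripE !S_rip // !ripE; ring.
Qed.

(** By [S_dyad], S (c z) = d S z for some d. Then |d| = |c| and Re d = Re c make d a root of (X -
    c)(X - cj c). *)
Let S_scale c z : perp z -> S (c *: z) = c *: S z \/ S (c *: z) = cj c *: S z.
Proof.
move=> z0; have cz0 := perpZ c z0; have [->|/eqP nz] := eqVneq z 0.
  left; have S0 : S 0 = 0 by apply: ip_eq0; rewrite S_norm ?ip0l // /perp ip0l.
  by rewrite scaler0 S0 scaler0.
have q0 : ip z z != 0 by apply/eqP => /ip_eq0.
have Sz0 : S z <> 0 by move=> S0; move: q0; rewrite -S_norm // S0 ip0l eqxx.
have st := S_transition cz0 z0.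
have : S (c *: z) = (ip (S (c *: z)) (S z) / ip (S z) (S z)) *: S z.
  apply: cauchy_schwarz_eq => //.
  by rewrite st !S_norm // !ipE; ring.
rewrite S_norm //; move: (_ / _) => d Sd.
have cq : cj (ip z z) = ip z z by rewrite -ipC.
have sr := S_re cz0 z0.
rewrite Sd !ipZl !ipZr !S_norm // in st sr.
have ddE : d * cj d = c * cj c.
  apply: (mulIf q0); apply: (mulIf q0).
  transitivity (d * ip z z * (cj d * ip z z)); first by ring.
  by rewrite st; ring.
have dcE : d + cj d = c + cj c.
  by apply: (mulIf q0); rewrite !mulrDl.
have : (d - c) * (d - cj c) = 0.
  have -> : (d - c) * (d - cj c) = d * d - (c + cj c) * d + c * cj c by ring.
  by rewrite -dcE -ddE; ring.
by move/eqP; rewrite mulf_eq0 !subr_eq0 Sd => /orP[] /eqP ->; [left|right].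
Qed.

(* The z with S (c z) = c (S z) and those with S (c z) = cj c (S z) are two
   subgroups covering the complement of e, so one of them is everything; then
   the same argument applies to the scalars c. *)
Let S_linear : (forall c z, perp z -> S (c *: z) = c *: S z) \/
  (forall c z, perp z -> S (c *: z) = cj c *: S z).
Proof.
pose A c := forall z, perp z -> S (c *: z) = c *: S z.
pose B c := forall z, perp z -> S (c *: z) = cj c *: S z.
have AB c : A c \/ B c.
  apply: union_subgroups; first exact: perpDD; last by move=> z; apply: S_scale.
  - move=> x y x0 y0; have cx0 := perpZ c x0; have cy0 := perpZ c y0.
    rewrite scalerDr !S_add // scalerDr.
    by move=> + E; rewrite E; apply: addIr.
  - move=> x y x0 y0; have cx0 := perpZ c x0; have cy0 := perpZ c y0.
    rewrite scalerDr !S_add // scalerDr.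
    by move=> + E; rewrite E; apply: addrI.
have [] := @union_subgroups _ (fun=> True) A B; rewrite /A /B //.
- move=> c d _ _ AD Ad z z0; have := AD z z0.
  have cz0 := perpZ c z0; have dz0 := perpZ d z0.
  rewrite !scalerDl S_add // Ad //; exact: addIr.
- move=> c d _ _ BD Bc z z0; have := BD z z0.
  have cz0 := perpZ c z0; have dz0 := perpZ d z0.
  rewrite rmorphD !scalerDl S_add // Bc //; exact: addrI.
- by move=> c _; apply: AB.
- by move=> h; left=> c; apply: h.
- by move=> h; right=> c; apply: h.
Qed.

Let component x : exists p,
  [/\ perp p, x - ip x e *: e = p & x = ip x e *: e + p].
Proof.
exists (x - ip x e *: e); split=> //; last by rewrite addrC subrK.
by rewrite /perp ipBl ipZl e1 mulr1 subrr.
Qed.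

(** [tau] will be the identity or [cj], which treats the linear and conjugate-linear cases at
    once. *)
Let wigner_extend (tau : {rmorphism K -> K}) :
  (forall c, tau c * cj (tau c) = c * cj c) ->
  (forall c z, perp z -> S (c *: z) = tau c *: S z) ->
  exists V, [/\ forall a x y, V (a *: x + y) = tau a *: V x + V y,
    forall x, ip (V x) (V x) = ip x x & forall x, dyad (f x) =1 dyad (V x)].
Proof.
move=> tau_norm Stau.
exists (fun x => tau (ip x e) *: e' + S (x - ip x e *: e)); split.
- move=> a x y; have [p [p0 pE _]] := component x.
  have [q [q0 qE _]] := component y.
  have -> : a *: x + y - ip (a *: x + y) e *: e = a *: p + q.
    by rewrite -pE -qE !ipE scalerBr scalerDl scalerA opprD addrACA.
  have ap0 := perpZ a p0; rewrite pE qE S_add // Stau // !ipE rmorphD rmorphM.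
  by rewrite scalerDl scalerDr scalerA addrACA.
- move=> x; have [p [p0 -> xE]] := component x.
  rewrite {3 4}xE !ipE e1 e1' S_perp ?S_perp' // S_norm // p0 perp_sym //.
  by rewrite !mulr1 !mulr0 !addr0 !add0r tau_norm.
move=> x; have [p [p0 -> xE]] := component x.
have [a0|a0] := eqVneq (ip x e) 0.
  have -> : x = p by rewrite xE a0 scale0r add0r.
  by rewrite p0 rmorph0 scale0r add0r; apply/fsym/S_dyad.
(* Now x = a (e + z) and V x = tau(a) g z, while f x agrees with a f (e + z) up to a phase. *)
move: (ip x e) xE a0 => a -> a0; pose z := a^-1 *: p.
have z0 : perp z by apply: perpZ.
have -> : p = a *: z by rewrite scalerA divff // scale1r.
rewrite Stau // -!scalerDr -gE => y.
rewrite wigner_scale 2!dyadZ g_dyad // mulrC [in RHS]mulrC.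
by rewrite tau_norm.
Qed.

Lemma wigner : exists V, [/\ linear_op V \/ conj_linear_op cj V,
  forall x, ip (V x) (V x) = ip x x & forall x, dyad (f x) =1 dyad (V x)].
Proof.
case: S_linear => [|] SL.
  have [//|V [lV nV dV]] := wigner_extend (tau := idfun) _ SL.
  by exists V; split=> //; left.
have [c|V [lV nV dV]] := wigner_extend _ SL; first by rewrite cjK mulrC.
by exists V; split=> //; right.
Qed.
End Wigner.

(** * The Riesz representation and the conclusion *)

Lemma rip_cauchy_schwarz u v : rip u v ^+ 2 <= rip u u * rip v v.
Proof.
have [v0|/eqP v0] := eqVneq v 0.
  by rewrite v0 /rip !ip0r re0 expr0n mulr0.
have q0 : 0 < rip v v by rewrite lt_def rip_ge0 andbT; apply/eqP => /rip_eq0.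
have := rip_ge0 (iota (rip v v) *: u - iota (rip u v) *: v).
rewrite !ripE (ripC v u) => h; rewrite -subr_ge0 -(pmulr_rge0 _ q0).
by apply: le_trans h _; rewrite le_eqVlt; apply/orP; left; apply/eqP; ring.
Qed.

(* The representer minimises ||w||^2 - 2 Re (g w). *)
Lemma riesz (g : H -> K) (C : R) : ip_complete ip ->
  (forall a x y, g (a *: x + y) = a * g x + g y) ->
  (forall x, re (g x) ^+ 2 <= C * rip x x) ->
  exists w, forall x, g x = ip x w.
Proof.
move=> compl lg gC.
have gD x y : g (x + y) = g x + g y by have := lg 1 x y; rewrite scale1r mul1r.
have g0 : g 0 = 0 by apply: (@addIr _ (g 0)); rewrite -gD !add0r.
have gZ a x : g (a *: x) = a * g x by have := lg a x 0; rewrite g0 !addr0.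
pose J w := rip w w - 2 * re (g w).
have JE w : J w = rip w w - 2 * re (g w) by [].
move: J JE => J JE.
pose E : classical_sets.set R := fun r => exists w, r = J w.
have lbE : classical_sets.has_lbound E.
  (* With t = Re (g w), r = |w|^2 and c = |C|, t^2 <= c r gives 2 t <= r + c by the AM-GM
     inequality. *)
  exists (- `|C|) => _ [w ->]; rewrite JE.
  have := gC w; have := rip_ge0 w; have := ler_norm C; have := normr_ge0 C.
  move: (rip w w) (re (g w)) `|C| => r t c c0 Cc r0 tC.
  have tc : t ^+ 2 <= c * r by apply: le_trans tC _; apply: ler_wpM2r.
  rewrite leNgt; apply/negP => lt; have lt' : r + c < 2 * t by lra.
  have : (r + c) ^+ 2 < (2 * t) ^+ 2 by apply: ltrXn2r => //; lra.
  by have := sqr_ge0 (r - c); rewrite !expr2 in tc *; lra.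
have infE : classical_sets.has_inf E by split=> //; exists (J 0); exists 0.
pose m := inf E.
have mJ w : m <= J w by apply: ge_inf => //; exists w.
have /choice[u uJ] (k : nat) : exists w, J w < m + k.+1%:R^-1.
  have k0 : (0 : R) < k.+1%:R^-1 by rewrite invr_gt0 ltr0Sn.
  by have [_ [w ->] wm] := inf_adherent k0 infE; exists w.
have small (eps : R) : 0 < eps -> exists k : nat,
    forall i, (k <= i)%N -> i.+1%:R^-1 < eps.
  move=> eps0; exists (Num.bound eps^-1) => i ki.
  have ei : eps^-1 < i.+1%:R.
    apply: lt_le_trans (archi_boundP _) _; first by rewrite invr_ge0 ltW.
    by rewrite ler_nat ltnW.
  by rewrite -[eps]invrK ltf_pV2 ?posrE ?invr_gt0 ?ltr0Sn.
(* The parallelogram law, in which the terms in [g] cancel; it makes a minimising sequence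
   Cauchy. *)
have par v w : rip (v - w) (v - w) =
    2 * (J v + J w - 2 * J (iota 2^-1 *: (v + w))).
  by rewrite !JE gZ reZ gD reD !ripE (ripC w v); field.
have [eps eps0|l ul] := compl u.
  have [r r0 rE] := iota_ge0P (ltW eps0).
  have r_gt0 : 0 < r / 4.
    by rewrite divr_gt0 // -iota_lt rmorph0 -rE.
  have [k kP] := small _ r_gt0; exists k => i j ki kj.
  rewrite /nsq -rip_nsq rE iota_lt par.
  have := mJ (iota 2^-1 *: (u i + u j)); have := uJ i; have := uJ j.
  have := kP _ ki; have := kP _ kj.
  move: i.+1%:R^-1 j.+1%:R^-1 (J (u i)) (J (u j)) (J _) => a b c d h; lra.
have near (eps : R) : 0 < eps -> exists k : nat,
    k.+1%:R^-1 < eps /\ rip (u k - l) (u k - l) < eps.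
  move=> eps0; have [|k1 k1P] := ul (iota eps); first by rewrite -(rmorph0 iota) iota_lt.
  have [k2 k2P] := small _ eps0; exists (maxn k1 k2).
  split; first by apply: k2P; apply: leq_maxr.
  by rewrite -iota_lt rip_nsq; apply: k1P; apply: leq_maxl.
have re_eq x : re (ip x l - g x) = 0.
  have [->|/eqP x0] := eqVneq x 0; first by rewrite ip0l g0 subrr re0.
  have X0 : 0 < rip x x by rewrite lt_def rip_ge0 andbT; apply/eqP => /rip_eq0.
  rewrite reD reN -/(rip x l); apply/eqP; apply: contraT => d0.
  have d2 : 0 < (rip x l - re (g x)) ^+ 2 by rewrite lt_def sqrf_eq0 d0 sqr_ge0.
  (* The defect d at [l] is that at [u k] minus <x, u k - l>. This choice of [k] makes both squares
     less than d^2 / 4, contradicting d^2 <= 2 p^2 + 2 q^2 for d = p - q. *)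
  have [|k [k1 k2]] := near ((rip x l - re (g x)) ^+ 2 / (4 * rip x x)).
    by apply: divr_gt0 => //; apply: mulr_gt0.
  have cs := rip_cauchy_schwarz x (u k - l).
  have Jx (t : R) : J (u k + iota t *: x) =
      J (u k) + t ^+ 2 * rip x x + 2 * t * (rip x (u k) - re (g x)).
    by rewrite !JE gD gZ reD reZ !ripE (ripC (u k) x); ring.
  (* The minimum of [J] on the line through [u k] along [x] lies d^2 / |x|^2 below [J (u k)], d
     being the defect at [u k], yet is at least [m]. *)
  have opt : (rip x (u k) - re (g x)) ^+ 2 <= k.+1%:R^-1 * rip x x.
    have := mJ (u k + iota (- (rip x (u k) - re (g x)) / rip x x) *: x).
    rewrite Jx; have := uJ k; move: k.+1%:R^-1 (J (u k)) => e j je.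
    have Xn0 : rip x x != 0 by rewrite gt_eqF.
    move: (rip x (u k) - _) => d; rewrite -ler_pdivrMr //.
    rewrite (_ : j + _ + _ = j - d ^+ 2 / rip x x); last by field.
    lra.
  rewrite ripDr ripNr in cs.
  move: k1 k2; rewrite !ltr_pdivlMr ?mulr_gt0 // => k1 k2.
  move: d2 k1 k2 opt cs; clear -X0.
  move: (rip x x) (rip x l) (rip x (u k)) (re (g x)) X0 => X a b c X0.
  move: k.+1%:R^-1 (rip (u k - l) (u k - l)) => e r.
  have := sqr_ge0 (b - c + (b - a)); rewrite !expr2; lra.
exists l => x; apply/eqP; rewrite -subr_eq0 -oppr_eq0 opprB; apply/eqP.
set d := _ - g x; apply: mul_cj_eq0.
rewrite -(@iota_re_fix (d * cj d)); last by rewrite rmorphM cjK mulrC.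
(* Testing on [cj d *: x] turns the defect into |d|^2, so its real part decides. *)
have := re_eq (cj d *: x); rewrite ipZl gZ -mulrBr -/d mulrC => ->.
by rewrite rmorph0.
Qed.

(** If P is the sum of the b_i b_i^*, then phi(P) is the sum of the dyads of V b_i, which is V P
    V^*; the adjoint comes from [riesz]. *)
Lemma angle_preserving_implemented : ip_complete ip -> forall n, (1 < n)%N ->
  forall phi : Pn ip n -> Pn ip n,
  (forall P Q, same_angle ip (sval (phi P)) (sval (phi Q)) (sval P) (sval Q)) ->
  exists V Vs : H -> H,
    ((linear_op V /\ forall x y, ip (V x) y = ip x (Vs y)) \/
     (conj_linear_op cj V /\ forall x y, ip (V x) y = cj (ip x (Vs y)))) /\
    (forall x, nsq ip (V x) = nsq ip x) /\
    (forall P : Pn ip n, sval (phi P) = V \o sval P \o Vs).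
Proof.
move=> compl n n1 phi phi_angle.
have [f [rf ft]] := dyad_map phi_angle (ltnW n1).
have [e e1] := unit_vector_exists.
have [V [lV nV dV]] := wigner ft e1.
have phiE P x m b : sval P =1 oproj m b ->
    sval (phi P) x = \sum_(i < m) dyad (V (b i)) x.
  move=> Pb; have r0 : span_rel phi (fun=> 0) (fun=> 0).
    by apply: rel_ext (relZ 0 (rel_Pn phi P)) => y; rewrite rmorph0 scale0r.
  have rs := rel_sum (index_enum 'I_m) r0 (fun (i : 'I_m) (_ : true) => rf (b i)).
  rewrite (rel_fun phi_angle (rel_Pn phi P) rs Pb).
  by apply: eq_bigr => i _; apply: dV.
have bound y x : rip (V x) y ^+ 2 <= rip y y * rip x x.
  apply: le_trans (rip_cauchy_schwarz _ _) _; rewrite mulrC ler_wpM2l ?rip_ge0 //.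
  by rewrite /rip nV.
have V_add : forall x y, V (x + y) = V x + V y.
  by move=> x y; case: lV => [/(_ 1 x y)|/(_ 1 x y)]; rewrite ?rmorph1 !scale1r.
have V0 : V 0 = 0 by apply: (@addIr _ (V 0)); rewrite -V_add !add0r.
have V_sum m (F : 'I_m -> H) : V (\sum_(i < m) F i) = \sum_(i < m) V (F i).
  exact: (big_morph V).
case: lV => lV.
  have /choice[Vs VsP] y : exists w, forall x, ip (V x) y = ip x w.
    by apply: (riesz compl) (bound y) => a x z; rewrite lV !ipE.
  exists V, Vs; split; first by left.
  split=> // P; apply/funext => x /=; have [m [b [_ Pb]]] := Pn_orthonormal P.
  rewrite (phiE _ _ _ _ Pb) Pb V_sum; apply: eq_bigr => i _.
  by rewrite (linear_opZ _ _ lV) /dyad ipC VsP -ipC.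
(* For conjugate-linear [V] the functional linear in [x] is the conjugate of <V x, y>. *)
have /choice[Vs VsP] y : exists w, forall x, cj (ip (V x) y) = ip x w.
  apply: (@riesz (fun x => cj (ip (V x) y)) (rip y y)) => // [a x z|x].
    by rewrite lV !ipE rmorphD rmorphM cjK.
  by rewrite re_cj; apply: bound.
exists V, Vs; split; first by right; split=> // x y; rewrite -VsP cjK.
split=> // P; apply/funext => x /=; have [m [b [_ Pb]]] := Pn_orthonormal P.
rewrite (phiE _ _ _ _ Pb) Pb V_sum; apply: eq_bigr => i _.
by have := lV (ip (Vs x) (b i)) (b i) 0; rewrite !addr0 V0 addr0 => ->;
  rewrite /dyad -ipC -VsP -ipC.
Qed.
End Hilbert.

(** * The real and the complex scalars *)

Lemma conj_scalars_real (R : realType) : @conj_scalars R R idfun idfun idfun.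
Proof.
split=> //= x; first by rewrite -expr2 sqr_ge0.
by field.
Qed.

Lemma conj_scalars_complex (R : realType) :
  @conj_scalars R R[i] Num.conj (real_complex R) (@complex.Re R).
Proof.
split.
- exact: conjCK.
- by move=> x; rewrite -normCK exprn_ge0.
- exact: geC0_conj.
- exact: conjc_real.
- exact: ler0c.
- exact: ReJ_add.
Qed.

Theorem theorem2 (R : realType) :
  (* real Hilbert spaces *)
  (forall (H : lmodType R) (ip : H -> H -> R), theorem2_for id ip) /\
  (* complex Hilbert spaces *)
  (forall (H : lmodType R[i]) (ip : H -> H -> R[i]),
      theorem2_for (@Num.Def.conjC _) ip).
Proof.
split=> H ip [ip_inner compl] inf_dim.
  exact: (angle_preserving_implemented (conj_scalars_real R) ip_inner inf_dim compl).
exact: (angle_preserving_implemented (conj_scalars_complex R) ip_inner inf_dim compl).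
Qed.
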